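(* Let $(S,\lhd)$ be a self-similar structure of a semi-monoidal category $(\mathcal C,\otimes)$. Then $(\mathcal C_S,\otimes)$, $(\mathcal F_S,\Box)$ and $(End(x),\star)$ are semi-monoidally equivalent.
   Context: A semi-monoidal category is a category $\mathcal C$ with a functor $\otimes:\mathcal C\times\mathcal C\to\mathcal C$ and natural isomorphisms $\tau_{X,Y,Z}:X\otimes(Y\otimes Z)\to(X\otimes Y)\otimes Z$ satisfying MacLane's pentagon condition; no unit object is assumed. Standing convention: every object $A$ of a semi-monoidal category is faithful, i.e. the functors $A\otimes\_$ and $\_\otimes A$ are faithful. A functor between semi-monoidal categories that (strictly) preserves the tensor is a (strict) semi-monoidal functor, and a semi-monoidal equivalence is an equivalence of categories in the evident semi-monoidal sense. A self-similar structure $(S,\lhd)$ of $\mathcal C$ consists of an object $S$ and an isomorphism $\lhd:S\otimes S\to S$, with inverse $\rhd=\lhd^{-1}$. $\mathrm{Tree}$ is the set of non-empty binary trees over a symbol $x$: $x\in\mathrm{Tree}$, and $(u\Box v)\in\mathrm{Tree}$ for all $u,v\in\mathrm{Tree}$. Define $Inst(x)=S$, $Inst(p\Box q)=Inst(p)\otimes Inst(q)$. The semi-monoidal category $(\mathcal F_S,\Box)$ freely generated by $S$ has $Ob(\mathcal F_S)=\mathrm{Tree}$, $\mathcal F_S(u,v)=\mathcal C(Inst(u),Inst(v))$, composition inherited from $\mathcal C$, tensor $u\Box v$ on objects and $f\Box g=f\otimes g$ on arrows, and associativity isomorphisms $t_{u,v,w}=\tau_{Inst(u),Inst(v),Inst(w)}$.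 $(\mathcal C_S,\otimes)$ is the full semi-monoidal subcategory of $\mathcal C$ on the objects $Inst(u)$, $u\in\mathrm{Tree}$. $End(x)$ is the monoid $\mathcal F_S(x,x)=\mathcal C(S,S)$ regarded as a one-object category, with the semi-monoidal tensor $f\star g=\lhd\,(f\Box g)\,\rhd$ and associativity isomorphism $\lhd(\lhd\Box 1_x)\,t_{x,x,x}\,(1_x\Box\rhd)\rhd$. Composition is written right to left. *)

(* Defs.v *)
From mathcomp Require Import ssreflect ssrfun.

Set Implicit Arguments.
Unset Strict Implicit.
Unset Printing Implicit Defensive.

Declare Scope cat_scope.
Delimit Scope cat_scope with cat.
Local Open Scope cat_scope.

Record Category := MkCategory {
  Ob :> Type;
  Hom : Ob -> Ob -> Type;
  idm : forall A, Hom A A;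
  comp : forall A B C, Hom B C -> Hom A B -> Hom A C;
  comp_idl : forall A B (f : Hom A B), comp (idm B) f = f;
  comp_idr : forall A B (f : Hom A B), comp f (idm A) = f;
  comp_assoc : forall A B C D (h : Hom C D) (g : Hom B C) (f : Hom A B),
    comp h (comp g f) = comp (comp h g) f
}.
Arguments Hom {_} _ _.
Arguments idm {_} _.
Arguments comp {_ _ _ _} _ _.
Notation "g ∘ f" := (comp g f) (at level 40, left associativity) : cat_scope.

Record Iso (C : Category) (A B : C) := MkIso {
  iso_fwd :> Hom A B;
  iso_bwd : Hom B A;
  iso_bwdK : iso_bwd ∘ iso_fwd = idm A;
  iso_fwdK : iso_fwd ∘ iso_bwd = idm B
}.
Arguments MkIso {_ _ _} _ _ _ _.

Record Functor (C D : Category) := MkFunctor {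
  fob :> C -> D;
  fmap : forall A B : C, Hom A B -> Hom (fob A) (fob B);
  fmap_id : forall A : C, fmap (idm A) = idm (fob A);
  fmap_comp : forall (A B E : C) (g : Hom B E) (f : Hom A B),
    fmap (g ∘ f) = fmap g ∘ fmap f
}.
Arguments fmap {_ _} _ {_ _} _.

Definition Faithful (C D : Category) (F : Functor C D) : Prop :=
  forall (A B : C) (f g : Hom A B), fmap F f = fmap F g -> f = g.

Definition IdFunctor (C : Category) : Functor C C.
Proof. by exists (fun A => A) (fun A B f => f). Defined.

Definition CompFunctor (C D E : Category) (G : Functor D E) (F : Functor C D) :
  Functor C E.
Proof.
exists (fun A => G (F A)) (fun A B f => fmap G (fmap F f)).
- by move=> A; rewrite !fmap_id.
- by move=> *; rewrite !fmap_comp.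
Defined.

Definition ProdCat (C D : Category) : Category.
Proof.
exists (C * D)%type
       (fun A B => (Hom A.1 B.1 * Hom A.2 B.2)%type)
       (fun A => (idm A.1, idm A.2))
       (fun A B E g f => (g.1 ∘ f.1, g.2 ∘ f.2)).
- by move=> A B [f1 f2]; rewrite /= !comp_idl.
- by move=> A B [f1 f2]; rewrite /= !comp_idr.
- by move=> *; rewrite /= !comp_assoc.
Defined.

Definition tob (C : Category) (T : Functor (ProdCat C C) C) (A B : C) : C :=
  T (A, B).

Definition thom (C : Category) (T : Functor (ProdCat C C) C) (A A' B B' : C)
    (f : Hom A A') (g : Hom B B') : Hom (tob T A B) (tob T A' B') :=
  @fmap _ _ T (A, B) (A', B') (f, g).

Lemma thom_id (C : Category) (T : Functor (ProdCat C C) C) (A B : C) :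
  thom T (idm A) (idm B) = idm (tob T A B).
Proof. exact: (@fmap_id _ _ T (A, B)). Qed.

Lemma thom_comp (C : Category) (T : Functor (ProdCat C C) C)
    (A A' A'' B B' B'' : C) (f' : Hom A' A'') (f : Hom A A')
    (g' : Hom B' B'') (g : Hom B B') :
  thom T (f' ∘ f) (g' ∘ g) = thom T f' g' ∘ thom T f g.
Proof.
exact: (@fmap_comp _ _ T (A, B) (A', B') (A'', B'') (f', g') (f, g)).
Qed.

Definition LeftTensor (C : Category) (T : Functor (ProdCat C C) C) (A : C) :
  Functor C C.
Proof.
exists (fun B => tob T A B) (fun B B' f => thom T (idm A) f).
- by move=> B; rewrite thom_id.
- by move=> *; rewrite -thom_comp comp_idl.
Defined.

Definition RightTensor (C : Category) (T : Functor (ProdCat C C) C) (A : C) :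
  Functor C C.
Proof.
exists (fun B => tob T B A) (fun B B' f => thom T f (idm A)).
- by move=> B; rewrite thom_id.
- by move=> *; rewrite -thom_comp comp_idl.
Defined.

(* No unit object is assumed.  The last two fields are the standing convention
   that all objects of a semi-monoidal category are faithful. *)
Record SemiMonCat := MkSemiMonCat {
  smcat :> Category;
  tensor : Functor (ProdCat smcat smcat) smcat;
  tau : forall X Y Z : smcat,
    Iso (tob tensor X (tob tensor Y Z)) (tob tensor (tob tensor X Y) Z);
  tau_natural : forall (X X' Y Y' Z Z' : smcat)
      (f : Hom X X') (g : Hom Y Y') (h : Hom Z Z'),
    tau X' Y' Z' ∘ thom tensor f (thom tensor g h)
    = thom tensor (thom tensor f g) h ∘ tau X Y Z;
  tau_pentagon : forall W X Y Z : smcat,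
    tau (tob tensor W X) Y Z ∘ tau W X (tob tensor Y Z)
    = thom tensor (tau W X Y) (idm Z) ∘ tau W (tob tensor X Y) Z
      ∘ thom tensor (idm W) (tau X Y Z);
  left_tensor_faithful : forall A : smcat, Faithful (LeftTensor tensor A);
  right_tensor_faithful : forall A : smcat, Faithful (RightTensor tensor A)
}.
Arguments tensor {_}.
Arguments tau {_} _ _ _.
Notation "A ⊗ B" := (tob tensor A B)
  (at level 39, no associativity) : cat_scope.
Notation "f ⊗h g" := (thom tensor f g)
  (at level 39, no associativity) : cat_scope.

(* The tensor is preserved up to a coherent natural isomorphism; a strict
   semi-monoidal functor is the case where [mu] is the identity. *)
Record SemiMonFunctor (C D : SemiMonCat) := MkSemiMonFunctor {
  smfun :> Functor C D;
  mu : forall X Y : C, Iso (smfun X ⊗ smfun Y) (smfun (X ⊗ Y));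
  mu_natural : forall (X X' Y Y' : C) (f : Hom X X') (g : Hom Y Y'),
    mu X' Y' ∘ (fmap smfun f ⊗h fmap smfun g) = fmap smfun (f ⊗h g) ∘ mu X Y;
  mu_tau : forall X Y Z : C,
    fmap smfun (tau X Y Z) ∘ mu X (Y ⊗ Z) ∘ (idm (smfun X) ⊗h mu Y Z)
    = mu (X ⊗ Y) Z ∘ (mu X Y ⊗h idm (smfun Z))
      ∘ tau (smfun X) (smfun Y) (smfun Z)
}.
Arguments mu {_ _} _ _ _.

Definition IdIso (C : Category) (A : C) : Iso A A :=
  MkIso (idm A) (idm A) (comp_idl (idm A)) (comp_idl (idm A)).

Definition CompIso (C : Category) (A B E : C) (g : Iso B E) (f : Iso A B) :
  Iso A E.
Proof.
exists (g ∘ f) (iso_bwd f ∘ iso_bwd g).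
- by rewrite comp_assoc -(comp_assoc (iso_bwd f)) iso_bwdK comp_idr iso_bwdK.
- by rewrite comp_assoc -(comp_assoc (iso_fwd g)) iso_fwdK comp_idr iso_fwdK.
Defined.

Definition MapIso (C D : Category) (F : Functor C D) (A B : C) (f : Iso A B) :
  Iso (F A) (F B).
Proof.
exists (fmap F f) (fmap F (iso_bwd f)).
- by rewrite -fmap_comp iso_bwdK fmap_id.
- by rewrite -fmap_comp iso_fwdK fmap_id.
Defined.

Definition IdSemiMon (C : SemiMonCat) : SemiMonFunctor C C.
Proof.
exists (IdFunctor C) (fun X Y => IdIso (X ⊗ Y)).
- by move=> * /=; rewrite comp_idl comp_idr.
- by move=> * /=; rewrite !thom_id !comp_idr !comp_idl.
Defined.

Definition CompSemiMon (C D E : SemiMonCat)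
  (G : SemiMonFunctor D E) (F : SemiMonFunctor C D) : SemiMonFunctor C E.
Proof.
exists (CompFunctor G F)
       (fun X Y => CompIso (MapIso G (mu F X Y)) (mu G (F X) (F Y))).
- move=> X X' Y Y' f g /=.
  rewrite -comp_assoc mu_natural comp_assoc -fmap_comp mu_natural.
  by rewrite fmap_comp -comp_assoc.
- move=> X Y Z /=.
  have splitr (A B1 B2 B3 : E) (g : Hom B2 B3) (f : Hom B1 B2) :
      idm A ⊗h (g ∘ f) = (idm A ⊗h g) ∘ (idm A ⊗h f).
    by rewrite -thom_comp comp_idl.
  have splitl (A B1 B2 B3 : E) (g : Hom B2 B3) (f : Hom B1 B2) :
      (g ∘ f) ⊗h idm A = (g ⊗h idm A) ∘ (f ⊗h idm A).
    by rewrite -thom_comp comp_idl.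
  rewrite splitr splitl.
  have nat1 := mu_natural G (idm (F X)) (mu F Y Z : Hom _ _).
  have nat2 := mu_natural G (mu F X Y : Hom _ _) (idm (F Z)).
  rewrite !fmap_id in nat1 nat2.
  rewrite !comp_assoc -(comp_assoc _ (mu G (F X) _ : Hom _ _)) nat1.
  rewrite -(comp_assoc _ (mu G (F (X ⊗ Y)) _ : Hom _ _)) nat2.
  rewrite !comp_assoc -!fmap_comp mu_tau !fmap_comp.
  by rewrite -!comp_assoc; do 2 congr (_ ∘ _); rewrite !comp_assoc mu_tau.
Defined.

Record SemiMonNatIso (C D : SemiMonCat) (F G : SemiMonFunctor C D) :=
  MkSemiMonNatIso {
  theta : forall X : C, Iso (F X) (G X);
  theta_natural : forall (X Y : C) (f : Hom X Y),
    theta Y ∘ fmap F f = fmap G f ∘ theta X;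
  theta_mu : forall X Y : C,
    theta (X ⊗ Y) ∘ mu F X Y = mu G X Y ∘ (theta X ⊗h theta Y)
}.

Definition SemiMonEquivalent (C D : SemiMonCat) : Prop :=
  exists (F : SemiMonFunctor C D) (G : SemiMonFunctor D C),
    inhabited (SemiMonNatIso (CompSemiMon G F) (IdSemiMon C))
    /\ inhabited (SemiMonNatIso (CompSemiMon F G) (IdSemiMon D)).

Record SelfSimilar (C : SemiMonCat) := MkSelfSimilar {
  ssob : C;
  lhd : Iso (ssob ⊗ ssob) ssob
}.
Arguments lhd {_} _.

Definition rhd (C : SemiMonCat) (s : SelfSimilar C) :
  Hom (ssob s) (ssob s ⊗ ssob s) := iso_bwd (lhd s).

Inductive Tree : Set := leaf | node (u v : Tree).

Fixpoint Inst (C : SemiMonCat) (S : C) (u : Tree) : C :=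
  match u with
  | leaf => S
  | node p q => Inst S p ⊗ Inst S q
  end.

Definition FreeCat (C : SemiMonCat) (S : C) : Category := {|
  Ob := Tree;
  Hom u v := @Hom C (Inst S u) (Inst S v);
  idm u := idm (Inst S u);
  comp _ _ _ g f := g ∘ f;
  comp_idl _ _ f := comp_idl f;
  comp_idr _ _ f := comp_idr f;
  comp_assoc _ _ _ _ h g f := comp_assoc h g f
|}.

Definition FreeTensor (C : SemiMonCat) (S : C) :
  Functor (ProdCat (FreeCat S) (FreeCat S)) (FreeCat S).
Proof.
exists (fun p : ProdCat (FreeCat S) (FreeCat S) =>
          node p.1 p.2 : FreeCat S)
       (fun p q f => @thom C tensor _ _ _ _ f.1 f.2).
- by move=> p; exact: thom_id.
- by move=> *; exact: thom_comp.
Defined.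

Definition FreeTau (C : SemiMonCat) (S : C) (u v w : FreeCat S) :
    Iso (tob (FreeTensor S) u (tob (FreeTensor S) v w))
        (tob (FreeTensor S) (tob (FreeTensor S) u v) w) :=
  let t := @tau C (Inst S u) (Inst S v) (Inst S w) in
  @MkIso (FreeCat S) (node u (node v w)) (node (node u v) w)
    (iso_fwd t) (iso_bwd t) (iso_bwdK t) (iso_fwdK t).

Definition FreeSemiMon (C : SemiMonCat) (S : C) : SemiMonCat.
Proof.
exists (FreeCat S) (FreeTensor S) (@FreeTau C S).
- by move=> X X' Y Y' Z Z' f g h; exact: (@tau_natural C).
- by move=> W X Y Z; exact: (@tau_pentagon C).
- move=> A X Y f g; exact: (@left_tensor_faithful C (Inst S A)).
- move=> A X Y f g; exact: (@right_tensor_faithful C (Inst S A)).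
Defined.

Definition FullSubCat (C : Category) (P : C -> Prop) : Category := {|
  Ob := { A : C | P A };
  Hom A B := @Hom C (proj1_sig A) (proj1_sig B);
  idm A := idm (proj1_sig A);
  comp _ _ _ g f := g ∘ f;
  comp_idl _ _ f := comp_idl f;
  comp_idr _ _ f := comp_idr f;
  comp_assoc _ _ _ _ h g f := comp_assoc h g f
|}.

Definition FullSubTensor (C : SemiMonCat) (P : C -> Prop)
    (HP : forall A B, P A -> P B -> P (A ⊗ B)) :
  Functor (ProdCat (FullSubCat P) (FullSubCat P)) (FullSubCat P).
Proof.
exists (fun p : ProdCat (FullSubCat P) (FullSubCat P) =>
          exist P (proj1_sig p.1 ⊗ proj1_sig p.2)
                  (HP _ _ (proj2_sig p.1) (proj2_sig p.2)) : FullSubCat P)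
       (fun p q f => @thom C tensor _ _ _ _ f.1 f.2).
- by move=> p; exact: thom_id.
- by move=> *; exact: thom_comp.
Defined.

Definition FullSubTau (C : SemiMonCat) (P : C -> Prop)
    (HP : forall A B, P A -> P B -> P (A ⊗ B)) (X Y Z : FullSubCat P) :
    Iso (tob (FullSubTensor HP) X (tob (FullSubTensor HP) Y Z))
        (tob (FullSubTensor HP) (tob (FullSubTensor HP) X Y) Z) :=
  let t := @tau C (proj1_sig X) (proj1_sig Y) (proj1_sig Z) in
  @MkIso (FullSubCat P)
    (tob (FullSubTensor HP) X (tob (FullSubTensor HP) Y Z))
    (tob (FullSubTensor HP) (tob (FullSubTensor HP) X Y) Z)
    (iso_fwd t) (iso_bwd t) (iso_bwdK t) (iso_fwdK t).

Definition FullSubSemiMon (C : SemiMonCat) (P : C -> Prop)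
  (HP : forall A B, P A -> P B -> P (A ⊗ B)) : SemiMonCat.
Proof.
exists (FullSubCat P) (FullSubTensor HP) (@FullSubTau C P HP).
- by move=> X X' Y Y' Z Z' f g h; exact: (@tau_natural C).
- by move=> W X Y Z; exact: (@tau_pentagon C).
- move=> A X Y f g; exact: (@left_tensor_faithful C (proj1_sig A)).
- move=> A X Y f g; exact: (@right_tensor_faithful C (proj1_sig A)).
Defined.

Definition is_inst (C : SemiMonCat) (S : C) (A : C) : Prop :=
  exists u : Tree, A = Inst S u.

Lemma is_inst_tensor (C : SemiMonCat) (S A B : C) :
  is_inst S A -> is_inst S B -> is_inst S (A ⊗ B).
Proof. by move=> [u ->] [v ->]; exists (node u v). Qed.

Definition InstSemiMon (C : SemiMonCat) (S : C) : SemiMonCat :=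
  FullSubSemiMon (@is_inst_tensor C S).

Section EndMonoid.
Variables (C : SemiMonCat) (s : SelfSimilar C).
Let F : SemiMonCat := FreeSemiMon (ssob s).
Let x : F := leaf.

(* [lhd s] and [rhd s], read as arrows of [F] between [x □ x] and [x]. *)
Let l : Hom (x ⊗ x) x := iso_fwd (lhd s).
Let r : Hom x (x ⊗ x) := rhd s.

Let rl : r ∘ l = idm (x ⊗ x).
Proof. exact: (iso_bwdK (lhd s)). Qed.

Let lr : l ∘ r = idm x.
Proof. exact: (iso_fwdK (lhd s)). Qed.

Let rlK (A : F) (f : Hom A (x ⊗ x)) : r ∘ (l ∘ f) = f.
Proof. by rewrite comp_assoc rl comp_idl. Qed.

Let thomK (A A' A'' B B' B'' E : F) (f' : Hom A' A'') (f : Hom A A')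
    (g' : Hom B' B'') (g : Hom B B') (k : Hom E (A ⊗ B)) :
  (f' ⊗h g') ∘ ((f ⊗h g) ∘ k) = ((f' ∘ f) ⊗h (g' ∘ g)) ∘ k.
Proof. by rewrite comp_assoc -thom_comp. Qed.

Definition EndCat : Category := {|
  Ob := unit;
  Hom _ _ := Hom x x;
  idm _ := idm x;
  comp _ _ _ g f := g ∘ f;
  comp_idl _ _ f := comp_idl f;
  comp_idr _ _ f := comp_idr f;
  comp_assoc _ _ _ _ h g f := comp_assoc h g f
|}.

Definition star (f g : Hom x x) : Hom x x := l ∘ (f ⊗h g) ∘ r.

Let star_id : star (idm x) (idm x) = idm x.
Proof. by rewrite /star thom_id comp_idr lr. Qed.

Let star_comp (g1 g2 f1 f2 : Hom x x) :
  star (g1 ∘ f1) (g2 ∘ f2) = star g1 g2 ∘ star f1 f2.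
Proof. by rewrite /star thom_comp -!comp_assoc rlK. Qed.

Definition EndTensor : Functor (ProdCat EndCat EndCat) EndCat.
Proof.
exists (fun _ : ProdCat EndCat EndCat => tt : EndCat)
       (fun _ _ f => star f.1 f.2).
- by move=> p; exact: star_id.
- by move=> p q t g f; exact: star_comp.
Defined.

Definition end_tau : Hom x x :=
  l ∘ (l ⊗h idm x) ∘ tau x x x ∘ (idm x ⊗h r) ∘ r.

Definition end_tau_inv : Hom x x :=
  l ∘ (idm x ⊗h l) ∘ iso_bwd (tau x x x) ∘ (r ⊗h idm x) ∘ r.

Let end_tau_invK : end_tau_inv ∘ end_tau = idm x.
Proof.
rewrite /end_tau /end_tau_inv -!comp_assoc rlK thomK rl comp_idl thom_id comp_idl.
rewrite (comp_assoc (iso_bwd (tau x x x))) iso_bwdK comp_idl.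
by rewrite thomK lr comp_idl thom_id comp_idl lr.
Qed.

Let end_tauK : end_tau ∘ end_tau_inv = idm x.
Proof.
rewrite /end_tau /end_tau_inv -!comp_assoc rlK thomK rl comp_idl thom_id comp_idl.
rewrite (comp_assoc (iso_fwd (tau x x x))) iso_fwdK comp_idl.
by rewrite thomK lr comp_idl thom_id comp_idl lr.
Qed.

Definition EndTau (X Y Z : EndCat) :
  Iso (tob EndTensor X (tob EndTensor Y Z))
      (tob EndTensor (tob EndTensor X Y) Z) :=
  @MkIso EndCat tt tt end_tau end_tau_inv end_tau_invK end_tauK.

Let tauK (X X' Y Y' Z Z' E : F) (f : Hom X X') (g : Hom Y Y')
    (h : Hom Z Z') (k : Hom E (X ⊗ (Y ⊗ Z))) :
  tau X' Y' Z' ∘ ((f ⊗h (g ⊗h h)) ∘ k) = ((f ⊗h g) ⊗h h) ∘ (tau X Y Z ∘ k).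
Proof. by rewrite comp_assoc tau_natural comp_assoc. Qed.

Let splitl (A B D E : F) (g : Hom D E) (f : Hom B D) :
  (g ∘ f) ⊗h idm A = (g ⊗h idm A) ∘ (f ⊗h idm A).
Proof. by rewrite -thom_comp comp_idl. Qed.

Let splitr (A B D E : F) (g : Hom D E) (f : Hom B D) :
  idm A ⊗h (g ∘ f) = (idm A ⊗h g) ∘ (idm A ⊗h f).
Proof. by rewrite -thom_comp comp_idl. Qed.

Let end_tau_natural (f g h : Hom x x) :
  end_tau ∘ star f (star g h) = star (star f g) h ∘ end_tau.
Proof.
have el : star (star f g) h = l ∘ (l ⊗h idm x) ∘ ((f ⊗h g) ⊗h h)
                                ∘ (r ⊗h idm x) ∘ r.
  by rewrite /star -!comp_assoc !thomK !comp_idl !comp_idr !comp_assoc.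
have er : star f (star g h) = l ∘ (idm x ⊗h l) ∘ (f ⊗h (g ⊗h h))
                                ∘ (idm x ⊗h r) ∘ r.
  by rewrite /star -!comp_assoc !thomK !comp_idl !comp_idr !comp_assoc.
rewrite el er /end_tau -!comp_assoc !rlK.
rewrite (thomK (idm x) (idm x) r l) rl comp_idl thom_id comp_idl tauK.
by rewrite (thomK r l) rl comp_idl thom_id comp_idl.
Qed.

Let end_tau_pentagon :
  end_tau ∘ end_tau
  = star end_tau (idm x) ∘ end_tau ∘ star (idm x) end_tau.
Proof.
have swap : (idm x ⊗h r) ∘ (l ⊗h idm x)
          = (l ⊗h (idm x ⊗h idm x)) ∘ ((idm x ⊗h idm x) ⊗h r).
  by rewrite -!thom_comp !thom_id !comp_idl !comp_idr.
have el : end_tau ∘ end_tau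
  = l ∘ (l ⊗h idm x) ∘ ((l ⊗h idm x) ⊗h idm x)
      ∘ (tau (x ⊗ x) x x ∘ tau x x (x ⊗ x))
      ∘ (idm x ⊗h (idm x ⊗h r)) ∘ (idm x ⊗h r) ∘ r.
  rewrite /end_tau -!comp_assoc rlK (comp_assoc (idm x ⊗h r)) swap.
  by rewrite -!comp_assoc !tauK.
rewrite el tau_pentagon /star /end_tau -!comp_assoc !rlK.
rewrite !splitl !splitr -!comp_assoc.
rewrite (thomK r l) rl comp_idl thom_id comp_idl.
rewrite (thomK (idm x) (idm x) r l) rl comp_idl thom_id comp_idl.
rewrite -(tauK (idm x) r (idm x)).
rewrite (thomK (idm x) (idm x) (r ⊗h idm x) (l ⊗h idm x)).
by rewrite -(thom_comp _ r l) rl !comp_idl !thom_id comp_idl.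
Qed.

Let star_faithfull (f g : Hom x x) : star (idm x) f = star (idm x) g -> f = g.
Proof.
move=> e; apply: (@left_tensor_faithful F x); rewrite /=.
have {e} : r ∘ star (idm x) f ∘ l = r ∘ star (idm x) g ∘ l by rewrite e.
by rewrite /star -!comp_assoc !rlK rl !comp_idr.
Qed.

Let star_faithfulr (f g : Hom x x) : star f (idm x) = star g (idm x) -> f = g.
Proof.
move=> e; apply: (@right_tensor_faithful F x); rewrite /=.
have {e} : r ∘ star f (idm x) ∘ l = r ∘ star g (idm x) ∘ l by rewrite e.
by rewrite /star -!comp_assoc !rlK rl !comp_idr.
Qed.

Definition EndSemiMon : SemiMonCat.
Proof.
exists EndCat EndTensor EndTau.
- by move=> X X' Y Y' Z Z' f g h; exact: end_tau_natural.
- by move=> W X Y Z; exact: end_tau_pentagon.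
- by move=> A X Y f g; exact: star_faithfull.
- by move=> A X Y f g; exact: star_faithfulr.
Defined.

End EndMonoid.

(* Main.v *)
From mathcomp Require Import ssreflect ssrfun.
From Stdlib Require Import IndefiniteDescription.
Require Import Defs.

Set Implicit Arguments.
Unset Strict Implicit.
Unset Printing Implicit Defensive.

Local Open Scope cat_scope.

(** A semi-monoidal functor that is fully faithful and essentially surjective
    is half of a semi-monoidal equivalence, exactly as for plain categories:
    the chosen preimages of objects carry a unique tensor comparison for which
    the chosen isomorphisms are monoidal ([weak_equivalence_equivalent]).  So
    it suffices to produce such functors between the three categories.

    Two of them act as the identity on hom-sets, which makes full faithfulness
    immediate: [free_to_inst], sending a tree [u] to [Inst S u], and
    [end_to_free], sending the one object of the endomorphism monoid to the
    tree [leaf].  The first has identity comparisons, and every object of its target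
    is by definition an instance of some tree.  For the second, the comparison
    is the self-similarity isomorphism [S ⊗ S -> S] itself.  The tensor and
    associator of the monoid are those of the ambient category conjugated by
    this isomorphism and its tensors with the identity, so the two axioms of a
    semi-monoidal functor are cancellations.  It is essentially surjective because, by self-similarity, [Inst S u] is isomorphic to [S]
    for every tree [u] ([inst_code]).  The third equivalence comes from the
    composite of these two functors. *)

(** * Isomorphisms in a category *)

Section Isomorphisms.
Variable C : Category.

Lemma iso_epi (A B E : C) (i : Iso A B) (f g : Hom B E) :
  f ∘ i = g ∘ i -> f = g.
Proof.
move=> /(f_equal (fun h => h ∘ iso_bwd i)).
by rewrite -!comp_assoc iso_fwdK !comp_idr.
Qed.

Lemma iso_mono (A B E : C) (i : Iso B E) (f g : Hom A B) :
  i ∘ f = i ∘ g -> f = g.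
Proof.
move=> /(f_equal (fun h => iso_bwd i ∘ h)).
by rewrite !comp_assoc iso_bwdK !comp_idl.
Qed.

Lemma iso_bwdKl (A B E : C) (i : Iso A B) (f : Hom E A) :
  iso_bwd i ∘ (i ∘ f) = f.
Proof. by rewrite comp_assoc iso_bwdK comp_idl. Qed.

Lemma iso_fwdKl (A B E : C) (i : Iso A B) (f : Hom E B) :
  i ∘ (iso_bwd i ∘ f) = f.
Proof. by rewrite comp_assoc iso_fwdK comp_idl. Qed.

Definition InvIso (A B : C) (i : Iso A B) : Iso B A :=
  MkIso (iso_bwd i) i (iso_fwdK i) (iso_bwdK i).

Definition iso_of_eq (A B : C) (e : A = B) : Iso A B :=
  match e with erefl => IdIso A end.

End Isomorphisms.

Definition ThomIso (C : SemiMonCat) (A A' B B' : C) (f : Iso A A')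
  (g : Iso B B') : Iso (A ⊗ B) (A' ⊗ B').
Proof.
exists (f ⊗h g) (iso_bwd f ⊗h iso_bwd g).
- by rewrite -thom_comp !iso_bwdK thom_id.
- by rewrite -thom_comp !iso_fwdK thom_id.
Defined.

(** * Weak equivalences are equivalences *)

(** Full faithfulness and essential surjectivity in skolemised form: the
    inverses on hom-sets and the preimages of objects are data, so that a
    quasi-inverse can be written down. *)
Record WeakEquivalence (D C : SemiMonCat) (F : SemiMonFunctor D C) :=
  MkWeakEquivalence {
  lift : forall A B : D, Hom (F A) (F B) -> Hom A B;
  liftK : forall (A B : D) (f : Hom (F A) (F B)), fmap F (lift f) = f;
  weq_faithful : Faithful F;
  rep : C -> D;
  rep_iso : forall X : C, Iso (F (rep X)) X
}.

Section QuasiInverse.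
Variables (D C : SemiMonCat) (F : SemiMonFunctor D C) (w : WeakEquivalence F).

Let e (X : C) : Iso (F (rep w X)) X := rep_iso w X.

Definition LiftIso (A B : D) (i : Iso (F A) (F B)) : Iso A B.
Proof.
exists (lift w i) (lift w (iso_bwd i)); apply: (weq_faithful w).
- by rewrite fmap_comp !liftK iso_bwdK fmap_id.
- by rewrite fmap_comp !liftK iso_fwdK fmap_id.
Defined.

Definition inv_map (X Y : C) (f : Hom X Y) : Hom (rep w X) (rep w Y) :=
  lift w (iso_bwd (e Y) ∘ (f ∘ e X)).

Lemma rep_iso_natural (X Y : C) (f : Hom X Y) :
  e Y ∘ fmap F (inv_map f) = f ∘ e X.
Proof. by rewrite liftK iso_fwdKl. Qed.

(** The quasi-inverse is built from values of [lift], and [F] determines them only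
    through their images.  This moves its axioms into [C], where [rep_iso_natural] and
    [rep_iso_mu] eliminate every lift. *)
Lemma rep_hom_eq (A : D) (X : C) (f g : Hom A (rep w X)) :
  e X ∘ fmap F f = e X ∘ fmap F g -> f = g.
Proof. by move=> /iso_mono /(weq_faithful w). Qed.

Definition InvFunctor : Functor C D.
Proof.
exists (rep w) inv_map.
- move=> X; apply: rep_hom_eq.
  by rewrite rep_iso_natural fmap_id comp_idl comp_idr.
- move=> X Y Z g f; apply: rep_hom_eq.
  rewrite fmap_comp comp_assoc !rep_iso_natural.
  by rewrite -!comp_assoc rep_iso_natural.
Defined.

Definition inv_mu (X Y : C) : Iso (rep w X ⊗ rep w Y) (rep w (X ⊗ Y)) :=
  LiftIso (CompIso (InvIso (e (X ⊗ Y)))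
    (CompIso (ThomIso (e X) (e Y)) (InvIso (mu F (rep w X) (rep w Y))))).

(** The property that forces the definition of [inv_mu]: it says that the
    isomorphisms [e] are compatible with tensors. *)
Lemma rep_iso_mu (X Y : C) :
  e (X ⊗ Y) ∘ (fmap F (inv_mu X Y) ∘ mu F (rep w X) (rep w Y)) = e X ⊗h e Y.
Proof. by rewrite /= liftK -!comp_assoc iso_bwdK comp_idr iso_fwdKl. Qed.

Lemma inv_mu_natural (X X' Y Y' : C) (f : Hom X X') (g : Hom Y Y') :
  inv_mu X' Y' ∘ (inv_map f ⊗h inv_map g) = inv_map (f ⊗h g) ∘ inv_mu X Y.
Proof.
apply: rep_hom_eq; apply: (@iso_epi _ _ _ _ (mu F _ _)).
rewrite !fmap_comp -!comp_assoc -mu_natural.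
rewrite (comp_assoc (fmap F (inv_mu _ _))) (comp_assoc (e _ : Hom _ _)).
rewrite rep_iso_mu (comp_assoc (e _ : Hom _ _)) rep_iso_natural.
by rewrite -comp_assoc rep_iso_mu -!thom_comp !rep_iso_natural.
Qed.

(** After applying [F], postcomposing with [e] and precomposing with the
    iterated comparison of [F], both sides become
    [tau X Y Z ∘ (e X ⊗h (e Y ⊗h e Z))]: the left one by naturality of [e]
    at [tau], the right one by coherence of [F] and naturality of [tau]. *)
Lemma inv_mu_tau (X Y Z : C) :
  inv_map (tau X Y Z) ∘ inv_mu X (Y ⊗ Z) ∘ (idm (rep w X) ⊗h inv_mu Y Z)
  = inv_mu (X ⊗ Y) Z ∘ (inv_mu X Y ⊗h idm (rep w Z))
    ∘ tau (rep w X) (rep w Y) (rep w Z).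
Proof.
set x := rep w X; set y := rep w Y; set z := rep w Z.
have rl : fmap F (idm x ⊗h inv_mu Y Z) ∘ mu F x (y ⊗ z)
        = mu F x (rep w (Y ⊗ Z)) ∘ (idm (F x) ⊗h fmap F (inv_mu Y Z)).
  by rewrite -mu_natural fmap_id.
have rr : fmap F (inv_mu X Y ⊗h idm z) ∘ mu F (x ⊗ y) z
        = mu F (rep w (X ⊗ Y)) z ∘ (fmap F (inv_mu X Y) ⊗h idm (F z)).
  by rewrite -mu_natural fmap_id.
apply: rep_hom_eq.
apply: (@iso_epi _ _ _ _ (mu F x (y ⊗ z))).
apply: (@iso_epi _ _ _ _ (ThomIso (IdIso (F x)) (mu F y z))).
rewrite /= !fmap_comp.
transitivity (tau X Y Z ∘ (e X ⊗h (e Y ⊗h e Z))).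
- rewrite !comp_assoc rep_iso_natural -!comp_assoc.
  rewrite (comp_assoc (fmap F (idm x ⊗h _))) rl -!comp_assoc -thom_comp comp_idl.
  rewrite (comp_assoc (fmap F (inv_mu _ _))) (comp_assoc (e _ : Hom _ _)).
  by rewrite rep_iso_mu -thom_comp comp_idr rep_iso_mu.
- rewrite tau_natural -!comp_assoc (comp_assoc (fmap F (tau x y z))) mu_tau.
  rewrite -!comp_assoc (comp_assoc (fmap F (_ ⊗h idm z))) rr.
  rewrite -!comp_assoc (comp_assoc (_ ⊗h idm (F z)) (_ ⊗h idm (F z))).
  rewrite -thom_comp comp_idl.
  rewrite (comp_assoc (fmap F (inv_mu _ _))) (comp_assoc (e _ : Hom _ _)).
  by rewrite rep_iso_mu comp_assoc -thom_comp comp_idr rep_iso_mu.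
Qed.

Definition InvSemiMon : SemiMonFunctor C D :=
  @MkSemiMonFunctor C D InvFunctor inv_mu inv_mu_natural inv_mu_tau.

Definition counit : SemiMonNatIso (CompSemiMon F InvSemiMon) (IdSemiMon C).
Proof.
exists e.
- by move=> X Y f; exact: rep_iso_natural.
- by move=> X Y /=; rewrite comp_idl; exact: rep_iso_mu.
Defined.

Definition unit_inv : SemiMonNatIso (CompSemiMon InvSemiMon F) (IdSemiMon D).
Proof.
exists (fun A => LiftIso (e (F A))).
- move=> A B f; apply: (weq_faithful w).
  by rewrite /= !fmap_comp !(liftK w (e _ : Hom _ _)) rep_iso_natural.
- move=> A B; apply: (weq_faithful w).
  apply: (@iso_epi _ _ _ _ (mu F _ _)).
  rewrite /= comp_idl !fmap_comp -mu_natural !(liftK w (e _ : Hom _ _)).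
  by rewrite comp_assoc rep_iso_natural -!comp_assoc rep_iso_mu.
Defined.

Lemma weak_equivalence_equivalent : SemiMonEquivalent C D.
Proof.
by exists InvSemiMon, F; split; constructor; [exact: counit | exact: unit_inv].
Qed.

End QuasiInverse.

Definition WeakEquivalence_comp (E D C : SemiMonCat) (G : SemiMonFunctor D C)
  (F : SemiMonFunctor E D) (wG : WeakEquivalence G) (wF : WeakEquivalence F) :
  WeakEquivalence (CompSemiMon G F).
Proof.
exists (fun A B f => lift wF (lift wG f)) (fun X => rep wF (rep wG X)).
- by move=> A B f /=; rewrite !liftK.
- by move=> A B f g /= /(weq_faithful wG) /(weq_faithful wF).
- by move=> X; exact: CompIso (rep_iso wG X) (MapIso G (rep_iso wF (rep wG X))).
Defined.

(** * From trees to their instances *)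

Section FreeToInst.
Variables (C : SemiMonCat) (S : C).

Definition inst_ob (u : FreeSemiMon S) : InstSemiMon S :=
  exist (is_inst S) (Inst S u) (ex_intro _ u erefl).

(** Objects of a full subcategory carry a proof of membership; this makes two
    objects isomorphic when they differ only in that proof. *)
Definition FullSubIso (D : Category) (P : D -> Prop) (A B : FullSubCat P)
    (i : Iso (proj1_sig A) (proj1_sig B)) : Iso A B :=
  @MkIso (FullSubCat P) A B (iso_fwd i) (iso_bwd i) (iso_bwdK i) (iso_fwdK i).

Definition FreeToInstFunctor : Functor (FreeSemiMon S) (InstSemiMon S).
Proof. by exists inst_ob (fun _ _ f => f). Defined.

Definition free_to_inst : SemiMonFunctor (FreeSemiMon S) (InstSemiMon S).
Proof.
exists FreeToInstFunctor
  (fun u v => @FullSubIso C (is_inst S) (inst_ob u ⊗ inst_ob v)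
    (inst_ob (u ⊗ v)) (IdIso (Inst S u ⊗ Inst S v))).
- move=> u u' v v' f g.
  exact: (etrans (@comp_idl C _ _ _) (esym (@comp_idr C _ _ _))).
- move=> u v t; rewrite /= !(@thom_id C) !(@comp_idr C).
  by rewrite (@comp_idl C).
Defined.

(** A choice is needed: an object of the target is only known to be an instance
    of some tree, and distinct trees may have the same instance. *)
Definition inst_tree (A : InstSemiMon S) :
    { u : Tree | proj1_sig A = Inst S u } :=
  constructive_indefinite_description _ (proj2_sig A).

Definition free_to_inst_weq : WeakEquivalence free_to_inst.
Proof.
exists (fun _ _ f => f) (fun A => proj1_sig (inst_tree A)) => //.
move=> A; apply: (@FullSubIso C (is_inst S) (inst_ob _) A).
exact: iso_of_eq (esym (proj2_sig (inst_tree A))).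
Defined.

End FreeToInst.

(** * From the endomorphism monoid to trees *)

Section EndToFree.
Variables (C : SemiMonCat) (s : SelfSimilar C).
Let S : C := ssob s.

(** Self-similarity expands [S] to every bracketed tensor power of [S], one node
    of the tree at a time. *)
Fixpoint inst_code (u : Tree) : Iso S (Inst S u) :=
  match u with
  | leaf => IdIso S
  | node p q => CompIso (ThomIso (inst_code p) (inst_code q)) (InvIso (lhd s))
  end.

Definition FreeIso (u v : FreeSemiMon S) (i : Iso (Inst S u) (Inst S v)) :
    Iso u v :=
  @MkIso (FreeSemiMon S) u v (iso_fwd i) (iso_bwd i) (iso_bwdK i) (iso_fwdK i).

Definition EndToFreeFunctor : Functor (EndSemiMon s) (FreeSemiMon S).
Proof. by exists (fun _ => leaf : FreeSemiMon S) (fun _ _ f => f). Defined.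

Definition end_to_free : SemiMonFunctor (EndSemiMon s) (FreeSemiMon S).
Proof.
exists EndToFreeFunctor
  (fun _ _ => @FreeIso (node leaf leaf) leaf (lhd s)).
- move=> X X' Y Y' f g.
  (* The tensor of the monoid, unfolded to a conjugate in the ambient category. *)
  change (iso_fwd (lhd s) ∘ (@thom C tensor S S S S f g)
    = iso_fwd (lhd s) ∘ (@thom C tensor S S S S f g) ∘ rhd s ∘ iso_fwd (lhd s)).
  by rewrite -!comp_assoc iso_bwdK comp_idr.
- move=> X Y Z.
  (* The two factors of the associator that are applied before [tau] are
     inverse to the two comparisons on the left-hand side. *)
  change (iso_fwd (lhd s) ∘ (iso_fwd (lhd s) ⊗h idm S) ∘ tau S S S
      ∘ (idm S ⊗h rhd s) ∘ rhd s ∘ iso_fwd (lhd s) ∘ (idm S ⊗h lhd s)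
    = iso_fwd (lhd s) ∘ (iso_fwd (lhd s) ⊗h idm S) ∘ tau S S S).
  rewrite -!comp_assoc iso_bwdKl -thom_comp iso_bwdK comp_idl thom_id.
  by rewrite comp_idr.
Defined.

Definition end_to_free_weq : WeakEquivalence end_to_free.
Proof.
exists (fun _ _ f => f) (fun _ => tt) => //.
by move=> u; exact: (@FreeIso leaf u (inst_code u)).
Defined.

End EndToFree.

(** * Equivalence of the three categories *)

Theorem theorem7p19 (C : SemiMonCat) (s : SelfSimilar C) :
  SemiMonEquivalent (InstSemiMon (ssob s)) (FreeSemiMon (ssob s)) /\
  SemiMonEquivalent (FreeSemiMon (ssob s)) (EndSemiMon s) /\
  SemiMonEquivalent (InstSemiMon (ssob s)) (EndSemiMon s).
Proof.
have wi := free_to_inst_weq (ssob s); have we := end_to_free_weq s.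
split; [| split].
- exact: weak_equivalence_equivalent wi.
- exact: weak_equivalence_equivalent we.
- exact: weak_equivalence_equivalent (WeakEquivalence_comp wi we).
Qed.
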